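(* Consider the network slicing model described in the context, with base stations $\mathcal{B}$, slices $\mathcal{V}$, shares $(s^v)$, loads $(\rho_b^v)$, overall loads $\rho^v$, relative loads $\tilde\rho_b^v$ and mean reciprocal capacities $\delta_b^v$. Let $v\in\mathcal V$. (i) Under Share Constrained Proportionally Fair (SCPF) sharing, the mean bit transmission delay (BTD) of a typical customer on slice $v$ is $$\mathbb{E}^v\left[\frac{1}{R^v}\right]=\sum_{b\in\mathcal{B}}\tilde\rho_b^v\,\delta_b^v\left(1-\tilde\rho_b^v+(\rho^v+1)\left(\frac{\tilde g_b'}{s^v}+e^{-\rho^v}\tilde\rho_b^v\right)\right).$$ (ii) If the relative loads $(\tilde{\boldsymbol\rho}^w:w\in\mathcal V)$ are fixed and the overall loads $(\rho^w:w\in\mathcal V)$ are large, then the SCPF mean BTD has the following asymptotic form: $$\mathbb{E}^v\left[\frac{1}{R^v}\right]\approx\frac{\rho^v}{s^v}\langle\tilde{\boldsymbol\rho}^v,\tilde{\boldsymbol g}\rangle_{\boldsymbol\Delta_v}+O(1).$$ (iii) Under Static Slicing (SS), the mean BTD of a typical customer on slice $v$ is $$\mathbb{E}^v\left[\frac{1}{R^{v,SS}}\right]=\sum_{b\in\mathcal{B}}\tilde\rho_b^v\,\delta_b^v\left(\frac{\rho_b^v+1}{s^v}\right).$$ (iv) Under General Processor Sharing (GPS), the mean BTD of a typical customer on slice $v$ is $$\mathbb{E}^v\left[\frac{1}{R^{v,GPS}}\right]=\sum_{b\in\mathcal{B}}\tilde\rho_b^v\,\delta_b^v\left(\frac{\rho_b^v+1}{s^v}\right)(1-\bar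 s_b^v).$$
   Context: Model. $\mathcal B$ (base stations) and $\mathcal V$ (slices) are finite nonempty sets. Each slice $v$ has a share $s^v>0$, with $\sum_{v\in\mathcal V}s^v=1$. The number $N_b^v$ of customers of slice $v$ at base station $b$ (in stationarity) is Poisson with mean $\rho_b^v\ge 0$, and the variables $(N_b^v)_{b\in\mathcal B,v\in\mathcal V}$ are mutually independent. Put $N^v=\sum_b N_b^v$, $\rho^v=\sum_b\rho_b^v>0$ (overall load). Each customer $u$ of slice $v$ at base station $b$ has a peak rate $c_u>0$; the peak rates are independent of each other and of the counts, and $c_u$ is distributed as a random variable $C_b^v$ with $\delta_b^v:=\mathbb E[1/C_b^v]\in(0,\infty)$. Rates. When the counts are $n_b^v$ and $n^v=\sum_b n_b^v$, a customer $u$ of slice $v$ at base station $b$ receives rate: - SS: $r_u^{SS}=\dfrac{s^v}{n_b^v}c_u$; - GPS: $r_u^{GPS}=\dfrac{s^v}{n_b^v\sum_{w\in\mathcal V}s^{w}\mathbf 1_{\{n_b^{w}>0\}}}c_u$; - SCPF: $r_u^{SCPF}=\dfrac{s^v/n^v}{\sum_{w\in\mathcal V:\,n^w>0}n_b^{w}s^{w}/n^{w}}c_u$. Mean BTD of a typical customer. $\mathbb E^v$ is expectation as seen by a typical (randomly selected) customer of slice $v$, i.e. under the Palm distribution: $\mathbb E^v[1/R^v]=\frac1{\rho^v}\mathbb E\big[\sum_{b}\sum_{u\in\mathcal U_b^v}1/r_u^{SCPF}\big]$, where $\mathcal U_b^v$ is the set of the $N_b^v$ customers of slice $v$ at $b$;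 $\mathbb E^v[1/R^{v,SS}]$ and $\mathbb E^v[1/R^{v,GPS}]$ are defined likewise with $r_u^{SS}$, $r_u^{GPS}$. Notation. $\tilde\rho_b^v=\rho_b^v/\rho^v$, $\tilde{\boldsymbol\rho}^v=(\tilde\rho_b^v)_b$; $\tilde{\boldsymbol g}=(\tilde g_b)_b$ with $\tilde g_b=\sum_{w\in\mathcal V}s^w\tilde\rho_b^w$; $\tilde g_b'=\sum_{w\in\mathcal V}s^w(1-e^{-\rho^w})\tilde\rho_b^w$; $\bar s_b^v=\sum_{w\ne v}s^{w}e^{-\rho_b^{w}}$; $\boldsymbol\Delta_v=\mathrm{diag}(\delta_b^v:b\in\mathcal B)$, and $\langle\boldsymbol x,\boldsymbol y\rangle_{\boldsymbol\Delta_v}=\boldsymbol x^T\boldsymbol\Delta_v\boldsymbol y$, so $\langle\tilde{\boldsymbol\rho}^v,\tilde{\boldsymbol g}\rangle_{\boldsymbol\Delta_v}=\sum_b\tilde\rho_b^v\delta_b^v\tilde g_b$.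
   Formalization: In (ii) the O(1) error is proved when ρ^v = O(exp(ρ^w)) for every slice w; without any relation between the loads it fails (e.g. ρ^v = exp(2ρ^w), shared base station). With no such relation, equivalence with the main term up to o(main term) is proved. *)

(* Defs.v *)
From HB Require Import structures.
From mathcomp Require Import all_boot all_order all_algebra.
From mathcomp Require Import finmap.
From mathcomp Require Import all_classical all_reals all_analysis.

Set Implicit Arguments.
Unset Strict Implicit.
Unset Printing Implicit Defensive.

Import Order.TTheory GRing.Theory Num.Theory.
Import numFieldNormedType.Exports.

Local Open Scope classical_set_scope.
Local Open Scope ring_scope.

(* Mutual independence of a family of systems of events: the product rule
   holds over every finite subfamily. *)
Definition mutually_independent (R : realType) (d : measure_display)
    (T : measurableType d) (P : probability T R) (I : choiceType)
    (F : I -> set_system T) : Prop :=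
  forall (J : {fset I}) (E : I -> set T),
    (forall i, i \in J -> F i (E i)) ->
    P (\bigcap_(i in [set` J]) E i) = (\prod_(i <- J) P (E i))%E.

Definition sigma_rv (d d' : measure_display) (T : measurableType d)
    (T' : measurableType d') (X : T -> T') : set_system T :=
  preimage_set_system [set: T] X measurable.

(* The sigma-algebras of all the counts [N b v] and of all the peak rates
   [c b v k], gathered in a single family. *)
Definition primitive_sigma (R : realType) (B V : finType) (d : measure_display)
    (T : measurableType d) (N : B -> V -> T -> nat)
    (c : B -> V -> nat -> T -> R) (i : (B * V) + (B * V * nat)) :
    set_system T :=
  match i with
  | inl (b, v) => sigma_rv (N b v)
  | inr (b, v, k) => sigma_rv (c b v k)
  end.

(* The customers of slice [v] at base station [b] are numbered [0], ...,
   [ncust b v - 1]; [peak b v] is an infinite sequence of potential peak rates,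
   of which only the first [ncust b v] terms are those of actual customers. *)
Record slicing_model (R : realType) (B V : finType) := SlicingModel {
  share : V -> R;
  share_gt0 : forall v, 0 < share v;
  share_sum1 : \sum_v share v = 1;
  load : B -> V -> R;
  load_ge0 : forall b v, 0 <= load b v;
  oload_gt0 : forall v, 0 < \sum_b load b v;
  sdisp : measure_display;
  sspace : measurableType sdisp;
  prob : probability sspace R;
  ncust : B -> V -> {RV prob >-> nat};
  (* The second argument of [poisson_prob] is not used by its definition; at
     mean 0 it is the Dirac mass at 0. *)
  ncust_poisson : forall b v (A : set nat),
    distribution prob (ncust b v) A = poisson_prob (load b v) 0 A;
  peak : B -> V -> nat -> {RV prob >-> R};
  peak_gt0 : forall b v k x, 0 < peak b v k x;
  cdisp : measure_display;
  cspace : measurableType cdisp;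
  cprob : probability cspace R;
  capacity : B -> V -> {RV cprob >-> R};
  peak_law : forall b v k (A : set R), measurable A ->
    distribution prob (peak b v k) A = distribution cprob (capacity b v) A;
  inv_capacity_gt0 : forall b v,
    (0 < 'E_cprob[fun x => ((capacity b v x)^-1)%R])%E;
  inv_capacity_lty : forall b v,
    ('E_cprob[fun x => ((capacity b v x)^-1)%R] < +oo)%E;
  primitives_independent :
    mutually_independent prob
      (primitive_sigma (fun b v => ncust b v : sspace -> nat)
                       (fun b v k => peak b v k : sspace -> R))
}.

Section rates.
Context {R : realType} {B V : finType}.
Variables (s : V -> R) (n : B -> V -> nat).
Implicit Types (b : B) (v w : V) (c : R).

Definition slice_count v : nat := (\sum_b n b v)%N.

Definition rate_SS b v c : R := s v / (n b v)%:R * c.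

Definition rate_GPS b v c : R :=
  s v / ((n b v)%:R * \sum_(w | (0 < n b w)%N) s w) * c.

Definition rate_SCPF b v c : R :=
  (s v / (slice_count v)%:R) /
  (\sum_(w | (0 < slice_count w)%N) (n b w)%:R * s w / (slice_count w)%:R) * c.

End rates.

Section model.
Context {R : realType} {B V : finType}.
Variable M : slicing_model R B V.
Implicit Types (b : B) (v w : V).

Definition oload v : R := \sum_b load M b v.

Definition rload b v : R := load M b v / oload v.

Definition delta b v : R := fine 'E_(cprob M)[fun x => ((capacity M b v x)^-1)%R].

Definition gtilde b : R := \sum_w share M w * rload b w.

Definition gtilde' b : R :=
  \sum_w share M w * (1 - expR (- oload w)) * rload b w.

Definition sbar b v : R := \sum_(w | w != v) share M w * expR (- load M b w).

(* <x, y>_{Delta_v} *)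
Definition delta_dot v (x y : B -> R) : R := \sum_b x b * delta b v * y b.

(* Mean BTD of a typical customer of slice [v] (Palm expectation of 1 / rate)
   when a customer with peak rate [c] of slice [v] at [b] is served at rate
   [rate s n b v c], [s] being the shares and [n] the vector of counts. It is
   the integral of a nonnegative function, hence valued in [\bar R]. *)
Definition mean_btd
    (rate : (V -> R) -> (B -> V -> nat) -> B -> V -> R -> R) v : \bar R :=
  ((oload v)^-1%:E *
   'E_(prob M)[fun x => (\sum_b \sum_(k < ncust M b v x)
      (rate (share M) (fun b' w => ncust M b' w x) b v (peak M b v k x))^-1)%R])%E.

End model.

(* Main.v *)
(** Conditioning on the whole vector [N] of counts replaces [1 / c] by its mean,
    so that the mean BTD of slice [v] is a sum over [b] of
    [delta b v * E[N_b^v h_b(N)] / rho^v], where [1 / rate = h_b(N) / c]. The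
    Mecke formula [E[N_i g(N)] = lambda_i E[g(N + e_i)]] for independent Poisson
    counts then does all the computations. For SCPF the only nontrivial term is
    [E[N_b^w / N^w] = rho_b^w E[1 / (N^w + 1)]]; summing it over [b] gives
    [rho^w E[1 / (N^w + 1)] = P(N^w > 0) = 1 - exp(- rho^w)], so the law of
    [N^w] is not needed. For the asymptotics, the difference between the exact
    formula and the main term is at most a constant times
    [1 + (rho^v + 1) * \sum_w exp(- rho^w)]. *)

Require Import Defs.
From HB Require Import structures.
From mathcomp Require Import all_boot all_order all_algebra.
From mathcomp Require Import finmap.
From mathcomp Require Import all_classical all_reals all_analysis.
From mathcomp Require Import measurable_realfun.
From mathcomp Require Import ring lra.

Set Implicit Arguments.
Unset Strict Implicit.
Unset Printing Implicit Defensive.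

Import Order.TTheory GRing.Theory Num.Theory.
Import numFieldNormedType.Exports.

Local Open Scope classical_set_scope.
Local Open Scope ring_scope.

(** * Expectations over a finite vector of counts and the Mecke formula *)

Section counts.
Context {R : realType} {d : measure_display} {T : measurableType d}.
Context {P : probability T R} {I : finType} (N : I -> {RV P >-> nat}).
Implicit Types (n : {ffun I -> nat}) (i : I) (g : {ffun I -> nat} -> R).

Definition counts (x : T) : {ffun I -> nat} := [ffun i => N i x].

Definition incr i n : {ffun I -> nat} := [ffun j => n j + (j == i)]%N.

Lemma incr_inj i : injective (incr i).
Proof.
move=> m n /ffunP mn; apply/ffunP => j; have := mn j.
by rewrite !ffunE => /addIn.
Qed.

Lemma countsE n : [set x | counts x = n] = \bigcap_(i in [set: I]) N i @^-1` [set n i].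
Proof.
apply/seteqP; split => x /= => [<- i _|xn]; first by rewrite /= ffunE.
by apply/ffunP => i; rewrite ffunE; exact: xn.
Qed.

Lemma measurable_counts_eq n : measurable [set x | counts x = n].
Proof.
rewrite countsE; apply: fin_bigcap_measurable => // i _.
by rewrite -[X in measurable X]setTI; exact: measurable_funPT.
Qed.

(** There are countably many count vectors, so a preimage is a countable union of pieces on which
    the vector is frozen. The extra argument of [F] leaves room for randomness beyond the counts,
    such as peak rates. *)
Lemma measurable_fun_counts_dep d' (U : measurableType d')
    (F : {ffun I -> nat} -> T -> U) :
  (forall n, measurable_fun [set: T] (F n)) ->
  measurable_fun [set: T] (fun x => F (counts x) x).
Proof.
move=> mF _ Y mY; rewrite setTI.
rewrite [X in measurable X](_ : _ = \bigcup_(n in [set: {ffun I -> nat}])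
  ([set x | counts x = n] `&` ([set: T] `&` F n @^-1` Y))); last first.
  apply/seteqP; split => x /= => [Yx|[n _ /= [<-] []]//].
  by exists (counts x).
apply: countable_bigcupT_measurable; first exact: countableP.
by move=> n; apply: measurableI; [exact: measurable_counts_eq|exact: mF].
Qed.

Lemma measurable_fun_counts d' (U : measurableType d')
    (F : {ffun I -> nat} -> U) : measurable_fun [set: T] (fun x => F (counts x)).
Proof. by apply: (@measurable_fun_counts_dep _ _ (fun n _ => F n)). Qed.

(** The space is cut along the [pickle] code of [F (counts x)]. Taking [F] to be [id] or [incr i]
    indexes both sides of the Mecke formula by the same [k], so that the two series are compared
    term by term. *)
Lemma integral_counts_decomp (F : {ffun I -> nat} -> {ffun I -> nat})
    (f : T -> \bar R) : measurable_fun [set: T] f -> (forall x, 0 <= f x)%E ->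
  (\int[P]_x f x =
   \sum_(k <oo) \int[P]_(x in [set x | choice.pickle (F (counts x)) = k]) f x)%E.
Proof.
move=> mf f0.
pose D k := (fun x => choice.pickle (F (counts x))) @^-1` [set k].
have UD : \bigcup_k D k = setT.
  by apply/seteqP; split => // x _; exists (choice.pickle (F (counts x))).
have mD k : measurable (D k).
  rewrite /D -[X in measurable X]setTI.
  exact: (@measurable_fun_counts _ nat (fun n => choice.pickle (F n))).
rewrite -[in LHS]UD; apply: ge0_integral_bigcup => //; last exact: trivIset_preimage1.
by rewrite -/D UD.
Qed.

Lemma pickle_counts_set (F : {ffun I -> nat} -> {ffun I -> nat}) n :
  [set x | choice.pickle (F (counts x)) = choice.pickle n] = [set x | F (counts x) = n].
Proof.
by apply/seteqP; split => x /=; [move/(pcan_inj choice.pickleK)|move=> ->].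
Qed.

Lemma integral_counts_eq g n :
  (\int[P]_(x in [set x | counts x = n]) (g (counts x))%:E =
   (g n)%:E * P [set x | counts x = n])%E.
Proof.
rewrite -integral_cst; last exact: measurable_counts_eq.
by apply: eq_integral => x; rewrite inE /= => ->.
Qed.

Definition Ecounts g : \bar R := (\int[P]_x (g (counts x))%:E)%E.

Lemma measurable_EFin_counts g : measurable_fun [set: T] (fun x => (g (counts x))%:E).
Proof. exact: (measurable_fun_counts (fun n => (g n)%:E)). Qed.

Lemma eq_Ecounts g h : g =1 h -> Ecounts g = Ecounts h.
Proof. by move=> gh; apply: eq_integral => x _; rewrite gh. Qed.

Lemma Ecounts_cst (c : R) : Ecounts (fun=> c) = c%:E.
Proof.
rewrite /Ecounts (integral_cst P measurableT c%:E).
by transitivity (c%:E * 1)%E; [congr mule; exact: probability_setT|rewrite mule1].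
Qed.

Lemma EcountsD g h : (forall n, 0 <= g n) -> (forall n, 0 <= h n) ->
  Ecounts (fun n => g n + h n) = (Ecounts g + Ecounts h)%E.
Proof.
move=> g0 h0; rewrite /Ecounts; under eq_integral do rewrite EFinD.
by rewrite ge0_integralD //; try (by move=> x _; rewrite lee_fin);
  exact: measurable_EFin_counts.
Qed.

Lemma EcountsZ (c : R) g : 0 <= c -> (forall n, 0 <= g n) ->
  Ecounts (fun n => c * g n) = (c%:E * Ecounts g)%E.
Proof.
move=> c0 g0; rewrite /Ecounts; under eq_integral do rewrite EFinM.
by rewrite ge0_integralZl_EFin //; try (by move=> x _; rewrite lee_fin);
  exact: measurable_EFin_counts.
Qed.

Lemma Ecounts_sum (J : Type) (r : seq J) (Q : pred J)
    (h : J -> {ffun I -> nat} -> R) : (forall j n, 0 <= h j n) ->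
  Ecounts (fun n => \sum_(j <- r | Q j) h j n) =
  (\sum_(j <- r | Q j) Ecounts (h j))%E.
Proof.
move=> h0; rewrite -[RHS]big_filter; under eq_Ecounts do rewrite -big_filter.
rewrite /Ecounts -ge0_integral_sum //.
- by apply: eq_integral => x _; rewrite sumEFin.
- by move=> j; exact: measurable_EFin_counts.
- by move=> j x _; rewrite lee_fin.
Qed.

Lemma Ecounts_indic (Q : pred {ffun I -> nat}) :
  Ecounts (fun n => (Q n)%:R) = P [set x | Q (counts x)].
Proof.
rewrite -[in RHS](setIT [set x | _]) -integral_indic //.
  by apply: eq_integral => x _; rewrite indicE mem_setE.
rewrite -[X in measurable X]setTI.
exact: (@measurable_fun_counts _ bool Q measurableT [set true]).
Qed.

Variables (p : I -> nat -> R) (lam : I -> R).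
Hypothesis pS : forall i k, k.+1%:R * p i k.+1 = lam i * p i k.
Hypothesis counts_pmf :
  forall n, P [set x | counts x = n] = (\prod_i p i (n i))%:E.

(** Only the [i]-th factor changes, and [pS] is the recurrence satisfied by Poisson weights. *)
Lemma pmf_incr i n :
  (n i).+1%:R * \prod_j p j (incr i n j) = lam i * \prod_j p j (n j).
Proof.
rewrite (bigD1 i) //= [X in _ = _ * X](bigD1 i) //= !mulrA ffunE eqxx addn1 pS.
by congr (_ * _); apply: eq_bigr => j /negPf ji; rewrite ffunE ji addn0.
Qed.

(** The left side is cut by the value [n] of the counts, the right side by the value [n] of the
    incremented counts. For [n = incr i m] the two terms agree by [pmf_incr]. *)
Lemma mecke i g : (forall n, 0 <= g n) ->
  (Ecounts (fun n => (n i)%:R * g n)%R =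
   (lam i)%:E * Ecounts (fun n => g (incr i n)))%E.
Proof.
move=> g0; rewrite /Ecounts.
rewrite (integral_counts_decomp id); first last.
- by move=> x; rewrite lee_fin mulr_ge0.
- exact: (measurable_EFin_counts (fun n => (n i)%:R * g n)).
rewrite [X in (_ * X)%E](integral_counts_decomp (incr i)); first last.
- by move=> x; rewrite lee_fin.
- exact: (measurable_EFin_counts (fun n => g (incr i n))).
rewrite -nneseriesZl; last first.
  by move=> k _; apply: integral_ge0 => x _; rewrite lee_fin.
apply: eq_eseriesr => k _.
have [[n <-]|nk] := pselect (exists n : {ffun I -> nat}, choice.pickle n = k); last first.
  rewrite (_ : [set x | _ ] = set0); last first.
    by apply/seteqP; split => // x /= xk; case: nk; exists (counts x).
  rewrite (_ : [set x | _ ] = set0); last first.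
    by apply/seteqP; split => // x /= xk; case: nk; exists (incr i (counts x)).
  by rewrite !integral_set0 mule0.
rewrite (pickle_counts_set id) (pickle_counts_set (incr i)).
rewrite (integral_counts_eq (fun n => (n i)%:R * g n)) /=.
(* A vector outside the range of [incr i] has [n i = 0], so both terms vanish. *)
have [[m <-{n}]|nm] := pselect (exists m, incr i m = n); last first.
  rewrite (_ : [set x | incr _ _ = _ ] = set0); last first.
    by apply/seteqP; split => // x /= xn; case: nm; exists (counts x).
  suff -> : n i = 0%N by rewrite integral_set0 mul0r mul0e mule0.
  apply/eqP; rewrite -leqn0 leqNgt; apply/negP => ni; case: nm.
  exists [ffun j => n j - (j == i)]%N; apply/ffunP => j; rewrite !ffunE.
  by rewrite subnK //; case: eqP => // ->.
rewrite (_ : [set x | incr _ _ = _ ] = [set x | counts x = m]); last first.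
  by apply/seteqP; split => x /=; [exact: incr_inj|move=> ->].
rewrite (integral_counts_eq (fun n => g (incr i n))) !counts_pmf -!EFinM.
congr EFin; rewrite ffunE eqxx addn1 mulrAC pmf_incr.
by rewrite mulrAC -mulrA.
Qed.

End counts.

(** * Mean reciprocals of random variables with the same law *)

Lemma measurable_inv (R : realType) : measurable_fun [set: R] (@GRing.inv R).
Proof.
have mN0 : measurable [set x : R | x != 0].
  rewrite [X in measurable X](_ : _ = ~` [set 0]); first exact: measurableC.
  by apply/seteqP; split => x /= /eqP.
rewrite (_ : [set: R] = [set 0] `|` [set x | x != 0]); last first.
  by apply/seteqP; split => // x _ /=; case: (eqVneq x 0); [left|right].
apply/measurable_funU => //; split; first exact: measurable_fun_set1.
apply: open_continuous_measurable_fun.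
  rewrite (_ : [set x | _] = ~` [set 0]); last first.
    by apply/seteqP; split => x /= /eqP.
  exact/closed_openC/closed_eq.
by move=> x; rewrite inE => /= x0; exact: inv_continuous.
Qed.

Section same_law.
Context {R : realType} {d d' : measure_display}.
Context {T : measurableType d} {T' : measurableType d'}.
Context (P : probability T R) (Q : probability T' R).
Variables (X : {RV P >-> R}) (Y : {RV Q >-> R}).
Hypothesis X_gt0 : forall x, 0 < X x.
Hypothesis XY : forall A : set R, measurable A ->
  distribution P X A = distribution Q Y A.

(* [Y] is positive only almost surely, since only its law is constrained. *)
Lemma expectation_inv_abs :
  ('E_Q[fun y => ((Y y)^-1)%R] = \int[Q]_y (`|(Y y)^-1|%R)%:E)%E.
Proof.
rewrite unlock; apply: ae_eq_integral => //.
- by apply/measurable_EFinP; exact: measurableT_comp (@measurable_inv R) _.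
- apply/measurable_EFinP; apply: measurableT_comp => //.
  exact: measurableT_comp (@measurable_inv R) _.
exists (Y @^-1` `]-oo, 0]); split.
- by rewrite -[X in measurable X]setTI; exact: measurable_funPT.
- transitivity (P (X @^-1` `]-oo, 0])).
    by apply/esym; exact: XY (measurable_itv _).
  rewrite (_ : _ @^-1` _ = set0) ?measure0 //.
  by apply/seteqP; split => // x /=; rewrite in_itv /= leNgt X_gt0.
- move=> y /= /not_implyP[_ neq]; rewrite in_itv /= leNgt; apply/negP => Y0.
  by apply: neq; rewrite ger0_norm // invr_ge0 ltW.
Qed.

(** By independence, the image under [X] of [P] restricted to [D] is [P D] times the law of [Y]. The
    absolute value makes the integrand nonnegative on all of [R], as the change of variables for
    nonnegative functions requires. *)
Lemma integral_inv_indep (D : set T) : measurable D ->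
  (forall A : set R, measurable A ->
    (P (D `&` X @^-1` A) = P D * P (X @^-1` A))%E) ->
  (\int[P]_(x in D) ((X x)^-1%R)%:E = P D * 'E_Q[fun y => ((Y y)^-1)%R])%E.
Proof.
move=> mD indep.
have minv : measurable_fun [set: R] (fun r : R => (`|r^-1|)%:E).
  by apply/measurable_EFinP; apply: measurableT_comp (@measurable_inv R).
have mX : measurable_fun [set: T] X by exact: measurable_funPT.
have mY : measurable_fun [set: T'] Y by exact: measurable_funPT.
have mXinv : measurable_fun [set: T] (fun x => (`|(X x)^-1|%R)%:E).
  exact: measurableT_comp minv mX.
transitivity (\int[pushforward (mrestr P mD) X]_r (`|r^-1|%R)%:E)%E.
  rewrite (ge0_integral_pushforward mX) //.
  rewrite -[_ @^-1` _]/[set: T].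
  (* The complement of [D] is null for the restricted measure, which brings the domain of
     integration back to [D]. *)
  rewrite (@ge0_negligible_integral _ _ _ _ setT (~` D)) //=; last first.
  - by rewrite /mrestr setICl measure0.
  - exact: measurableC.
  rewrite setTD setCK.
  rewrite [RHS](@eq_measure_integral _ _ _ _ P); last first.
    by move=> A mA AD; rewrite -[in RHS](setIidl AD).
  by apply: eq_integral => x _; rewrite /= ger0_norm // invr_ge0 ltW.
have PD0 : 0 <= fine (P D) by rewrite fine_ge0.
rewrite (@eq_measure_integral _ _ _ _ (mscale (NngNum PD0) (pushforward Q Y))).
  rewrite ge0_integral_mscale //.
  rewrite /= fineK ?fin_num_measure // expectation_inv_abs; congr (_ * _)%E.
  by rewrite (ge0_integral_pushforward mY).
move=> A mA _; rewrite /= /pushforward /mrestr /mscale /= setIC indep //.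
by rewrite fineK ?fin_num_measure //; congr (_ * _)%E; exact: XY.
Qed.

End same_law.

(** * Poisson point masses, and independence along finite sequences *)

Definition pois {R : realType} (l : R) (k : nat) : R :=
  fine (poisson_prob l 0 [set k]).

Lemma poisE {R : realType} (l : R) (k : nat) :
  pois l k = if 0 < l then l ^+ k / k`!%:R * expR (- l) else (k == 0%N)%:R.
Proof.
rewrite /pois /poisson_prob; case: ifPn => l0.
  by rewrite esum_set1 ?lee_fin ?poisson_pmf_ge0 //= /poisson_pmf l0.
rewrite diracE; case: (eqVneq k 0%N) => [->|k0]; first by rewrite mem_set.
by rewrite memNset //= => /esym/eqP; apply/negP.
Qed.

(** At [l = 0] the law is the Dirac mass at 0 and both sides vanish, so stations without load obey
    the same recurrence. *)
Lemma poisS {R : realType} (l : R) (k : nat) : 0 <= l ->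
  k.+1%:R * pois l k.+1 = l * pois l k.
Proof.
move=> l_ge0; rewrite !poisE; case: ltP => [_|l_le0].
  have k1 : k.+1%:R != 0 :> R by rewrite pnatr_eq0.
  have kf : k`!%:R != 0 :> R by rewrite pnatr_eq0 -lt0n fact_gt0.
  rewrite factS natrM exprS; move: k.+1%:R k1 => a a0; field.
  by rewrite kf.
have -> : l = 0 by apply/le_anti/andP.
by rewrite mulr0 mul0r.
Qed.

Lemma pois0 {R : realType} (l : R) : 0 <= l -> pois l 0 = expR (- l).
Proof.
move=> l_ge0; rewrite poisE; case: ltP => [_|l_le0].
  by rewrite expr0 fact0 invr1 mulr1 mul1r.
by have -> : l = 0 by [apply/le_anti/andP]; rewrite oppr0 expR0.
Qed.

Lemma poisson_prob_set1 {R : realType} (l : R) (k : nat) :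
  poisson_prob l 0 [set k] = (pois l k)%:E.
Proof.
rewrite /pois fineK // /poisson_prob; case: ifPn => l0; last by rewrite diracE.
by rewrite esum_set1 ?lee_fin ?poisson_pmf_ge0.
Qed.

Lemma mutually_independent_seq {R : realType} d (T : measurableType d)
    (P : probability T R) (I : choiceType) (F : I -> set_system T)
    (s : seq I) (E : I -> set T) :
  mutually_independent P F -> uniq s -> (forall i, i \in s -> F i (E i)) ->
  P (\bigcap_(i in [set` s]) E i) = (\prod_(i <- s) P (E i))%E.
Proof.
move=> indep us FE.
have sE i : (i \in seq_fset tt s) = (i \in s) by exact: seq_fsetE.
have -> : [set` s] = [set` seq_fset tt s].
  by apply/seteqP; split => i /=; rewrite sE.
rewrite indep => [|i]; last by rewrite sE; exact: FE.
apply: perm_big.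
by rewrite -[X in perm_eq _ X]undup_id // seq_fset_perm.
Qed.

(** * From the mean BTD to expectations over the counts *)

Section model.
Context {R : realType} {B V : finType}.
Variable M : slicing_model R B V.
Implicit Types (b : B) (v w : V) (n : {ffun B * V -> nat}).
Implicit Types (g : {ffun B * V -> nat} -> R).

Notation P := (prob M).

Definition ncust_pair (i : B * V) : {RV P >-> nat} := ncust M i.1 i.2.

Notation cnt := (counts ncust_pair).
Notation E := (Ecounts ncust_pair).

Lemma ncust_pmf b v k : P (ncust M b v @^-1` [set k]) = (pois (load M b v) k)%:E.
Proof. by rewrite -poisson_prob_set1 -ncust_poisson. Qed.

(** Mutual independence is applied to all the counts together with one peak rate. One peak rate at a
    time suffices, because the mean BTD is linear in the reciprocal peak rates. *)
Lemma counts_peak_indep n b v k (A : set R) : measurable A ->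
  (P ([set x | cnt x = n] `&` peak M b v k @^-1` A) =
   (\prod_i pois (load M i.1 i.2) (n i))%:E * P (peak M b v k @^-1` A))%E.
Proof.
move=> mA.
pose F (j : (B * V) + (B * V * nat)) : set (sspace M) :=
  match j with
  | inl i => ncust_pair i @^-1` [set n i]
  | inr _ => peak M b v k @^-1` A
  end.
pose s : seq ((B * V) + (B * V * nat)) :=
  inr (b, v, k) :: [seq inl i | i <- enum {: B * V}].
have := @mutually_independent_seq _ _ _ _ _ _ s F (@primitives_independent _ _ _ M).
rewrite big_cons big_map big_enum /= => indep.
rewrite setIC; transitivity (P (\bigcap_(i in [set` s]) F i)).
  congr (P _); rewrite countsE; apply/seteqP; split => x /=.
    move=> [xA xn] j /=; rewrite inE => /orP[/eqP ->//|/mapP[i _ ->]].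
    exact: xn.
  move=> xF; split; first by apply: (xF (inr (b, v, k))); rewrite /= mem_head.
  move=> i _; apply: (xF (inl i)); rewrite /= inE; apply/orP; right.
  by rewrite map_f // mem_enum.
rewrite indep.
- rewrite muleC; congr (_ * _)%E.
  by rewrite -prodEFin; apply: eq_bigr => -[b' w] _; exact: ncust_pmf.
- rewrite map_inj_uniq ?enum_uniq ?andbT; last by move=> i j [].
  by apply/mapP => -[].
- move=> j; rewrite inE => /orP[/eqP ->|/mapP[[b' w] _ ->]] /=.
    by exists A => //; rewrite setTI.
  by exists [set n (b', w)] => //; rewrite setTI.
Qed.

(* [b] and [v] only name a peak rate whose sure event takes the place of
   [peak M b v k @^-1` A] in [counts_peak_indep]. *)
Lemma counts_pmf b v n : P [set x | cnt x = n] =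
  (\prod_i pois (load M i.1 i.2) (n i))%:E.
Proof.
have := @counts_peak_indep n b v 0%N setT measurableT.
have -> : P (peak M b v 0%N @^-1` setT) = 1%E by exact: probability_setT.
by rewrite mule1 => <-; congr (P _); rewrite setIT.
Qed.

Lemma mecke_ncust b v g : (forall n, 0 <= g n) ->
  (E (fun n => (n (b, v))%:R * g n)%R =
   (load M b v)%:E * E (fun n => g (incr (b, v) n)))%E.
Proof.
apply: (@mecke _ _ _ P _ ncust_pair (fun i => pois (load M i.1 i.2))
  (fun i => load M i.1 i.2)) => [i k|n]; last exact: (counts_pmf b v).
by apply: poisS; exact: load_ge0.
Qed.

Lemma deltaE b v : ('E_(cprob M)[fun x => ((capacity M b v x)^-1)%R] = (delta M b v)%:E)%E.
Proof.
rewrite /delta fineK // ge0_fin_numE; first exact: inv_capacity_lty.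
exact/ltW/inv_capacity_gt0.
Qed.

Lemma delta_gt0 b v : 0 < delta M b v.
Proof. by rewrite -lte_fin -deltaE; exact: inv_capacity_gt0. Qed.

Lemma integral_inv_peak b v k n :
  (\int[P]_(x in [set x | cnt x = n]) ((peak M b v k x)^-1%R)%:E =
   P [set x | cnt x = n] * (delta M b v)%:E)%E.
Proof.
rewrite -deltaE.
have H := integral_inv_indep (@peak_gt0 _ _ _ M b v k) (@peak_law _ _ _ M b v k).
apply: (H [set x | cnt x = n]); first exact: measurable_counts_eq.
by move=> A mA; rewrite counts_peak_indep // -(counts_pmf b v).
Qed.

(** The number of summands is itself random; it becomes a constant once the count vector is
    frozen. *)
Lemma measurable_sum_peak b v (g : {ffun B * V -> nat} -> R) :
  measurable_fun [set: sspace M] (fun x => \sum_(k < ncust M b v x)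
    g (cnt x) * (peak M b v k x)^-1).
Proof.
pose F n (x : sspace M) := \sum_(k < n (b, v)) g n * (peak M b v k x)^-1.
rewrite (_ : (fun x => _) = (fun x => F (cnt x) x)); last first.
  by apply/funext => x /=; rewrite /F [in RHS]/counts ffunE.
apply: (@measurable_fun_counts_dep _ _ _ P _ ncust_pair _ R F) => n.
apply: measurable_sum => k; apply: measurable_funM => //.
by apply: (measurableT_comp (@measurable_inv R)); exact: measurable_funPT.
Qed.

(** This is conditioning on the counts: on the event that they equal [n], the sum has [n (b, v)]
    terms, and each integrates to [g n * delta M b v] times the probability of the event. *)
Lemma integral_sum_peak b v g : (forall n, 0 <= g n) ->
  (\int[P]_x (\sum_(k < ncust M b v x) g (cnt x) * (peak M b v k x)^-1)%:E =
   (delta M b v)%:E * E (fun n => (n (b, v))%:R * g n)%R)%E.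
Proof.
move=> g0; have d0 := ltW (delta_gt0 b v).
have mp k : measurable_fun [set: sspace M] (fun x => ((peak M b v k x)^-1)%:E).
  apply/measurable_EFinP; apply: (measurableT_comp (@measurable_inv R)).
  exact: measurable_funPT.
have p0 k x : 0 <= (peak M b v k x)^-1 by rewrite invr_ge0 ltW // peak_gt0.
rewrite /Ecounts (integral_counts_decomp ncust_pair id); first last.
- by move=> x; rewrite lee_fin sumr_ge0 // => k _; rewrite mulr_ge0.
- by apply/measurable_EFinP; exact: measurable_sum_peak.
rewrite [X in (_ * X)%E](integral_counts_decomp ncust_pair id); first last.
- by move=> x; rewrite lee_fin mulr_ge0.
- exact: (measurable_EFin_counts ncust_pair (fun n => (n (b, v))%:R * g n)).
rewrite -nneseriesZl; last first.
  by move=> k _; apply: integral_ge0 => x _; rewrite lee_fin mulr_ge0.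
apply: eq_eseriesr => k _.
have [[n <-]|nk] := pselect (exists n : {ffun B * V -> nat}, choice.pickle n = k); last first.
  rewrite (_ : [set x | _ ] = set0); last first.
    by apply/seteqP; split => // x /= xk; case: nk; exists (cnt x).
  by rewrite !integral_set0 mule0.
rewrite (pickle_counts_set ncust_pair id).
rewrite (integral_counts_eq ncust_pair (fun n => (n (b, v))%:R * g n)) /=.
under eq_integral => x; first rewrite inE /= => xn.
  rewrite xn (_ : ncust M b v x = n (b, v)); last by rewrite -xn ffunE.
  rewrite -sumEFin; under eq_bigr do rewrite EFinM.
  over.
have mn : measurable [set x | cnt x = n] by exact: measurable_counts_eq.
have mpn j : measurable_fun [set x | cnt x = n] (fun x => ((peak M b v j x)^-1)%:E).
  exact: measurable_funTS.
rewrite ge0_integral_sum //; first last.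
- by move=> j x _; rewrite mule_ge0 ?lee_fin.
- by move=> j; apply: emeasurable_funM => //.
under eq_bigr => j _.
  rewrite ge0_integralZl_EFin //; last by move=> x _; rewrite lee_fin.
  rewrite integral_inv_peak (counts_pmf b v) -!EFinM.
  over.
rewrite sumEFin sumr_const card_ord (counts_pmf b v) -!EFinM -mulr_natl.
by congr EFin; ring.
Qed.

(** The number of customers at [b] supplies a factor [n (b, v)], which the Mecke formula trades for
    [load M b v]; division by [oload M v] leaves [rload M b v]. The argument [incr (b, v) n] is what
    a typical customer sees: the stationary counts plus itself. *)
Lemma mean_btd_mecke (rate : (V -> R) -> (B -> V -> nat) -> B -> V -> R -> R)
    v (h : B -> {ffun B * V -> nat} -> R) :
  (forall b n, 0 <= h b n) ->
  (forall b n c, (rate (share M) (fun b' w => n (b', w)) b v c)^-1 = h b n * c^-1) ->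
  (mean_btd M rate v =
   \sum_b (rload M b v * delta M b v)%:E * E (fun n => h b (incr (b, v) n)))%E.
Proof.
move=> h0 rateE; rewrite /mean_btd unlock.
under eq_integral => x _.
  have -> : \sum_b \sum_(k < ncust M b v x)
      (rate (share M) (fun b' w => ncust M b' w x) b v (peak M b v k x))^-1 =
    \sum_b \sum_(k < ncust M b v x) h b (cnt x) * (peak M b v k x)^-1.
    apply: eq_bigr => b _; apply: eq_bigr => k _; rewrite -rateE.
    congr (rate _ _ _ _ _)^-1.
    by apply/funext => b'; apply/funext => w; rewrite ffunE.
  rewrite -sumEFin.
  over.
rewrite ge0_integral_sum //; first last.
- move=> b x _; rewrite lee_fin sumr_ge0 // => k _; rewrite mulr_ge0 // invr_ge0.
  by rewrite ltW // peak_gt0.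
- by move=> b; apply/measurable_EFinP; exact: measurable_sum_peak.
rewrite ge0_sume_distrr; last first.
  move=> b _; apply: integral_ge0 => x _; rewrite lee_fin sumr_ge0 // => k _.
  by rewrite mulr_ge0 // invr_ge0 ltW // peak_gt0.
apply: eq_bigr => b _; rewrite integral_sum_peak // mecke_ncust //.
by rewrite !muleA -!EFinM; congr (_%:E * _)%E; rewrite /rload; ring.
Qed.

(** * Moments involving the total count of a slice *)

Definition slice_total n v : nat := \sum_b n (b, v).

Lemma oload_pos v : 0 < oload M v. Proof. exact: oload_gt0. Qed.

Lemma slice_total_incr n b v w :
  slice_total (incr (b, v) n) w = (slice_total n w + (w == v))%N.
Proof.
rewrite /slice_total; under eq_bigr do rewrite ffunE.
rewrite big_split /=; congr addn.
rewrite (bigD1 b) //= xpair_eqE eqxx /= big1 ?addn0 // => b' /negPf bb'.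
by rewrite xpair_eqE bb'.
Qed.

(** The second hypothesis says that [g] ignores the count at [(b, v)], so the Mecke shift leaves it
    unchanged. This does the work of factoring the expectation of a product of independent
    variables. *)
Lemma Ecounts_mul_ncust b v g : (forall n, 0 <= g n) ->
  (forall n, g (incr (b, v) n) = g n) ->
  (E (fun n => (n (b, v))%:R * g n)%R = (load M b v)%:E * E g)%E.
Proof. by move=> g0 gi; rewrite mecke_ncust //; under eq_Ecounts do rewrite gi. Qed.

Lemma Ecounts_succ_ncust b v g : (forall n, 0 <= g n) ->
  (forall n, g (incr (b, v) n) = g n) ->
  (E (fun n => (n (b, v)).+1%:R * g n)%R = (load M b v + 1)%:E * E g)%E.
Proof.
move=> g0 gi; have l0 := load_ge0 M b v.
under eq_Ecounts do rewrite -natr1 mulrDl mul1r.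
rewrite EcountsD // => [|n]; last by rewrite mulr_ge0.
by rewrite Ecounts_mul_ncust // EFinD ge0_muleDl ?lee_fin // mul1e.
Qed.

Lemma Ecounts_succ_slice v g : (forall n, 0 <= g n) ->
  (forall b n, g (incr (b, v) n) = g n) ->
  (E (fun n => (slice_total n v).+1%:R * g n)%R = (oload M v + 1)%:E * E g)%E.
Proof.
move=> g0 gi; have l0 := oload_pos v.
under eq_Ecounts do rewrite -natr1 natr_sum mulrDl mul1r mulr_suml.
rewrite EcountsD // => [|n]; last by rewrite sumr_ge0 // => b _; rewrite mulr_ge0.
rewrite Ecounts_sum => [|b n]; last by rewrite mulr_ge0.
under eq_bigr do rewrite Ecounts_mul_ncust //.
rewrite -ge0_sume_distrl => [|b _]; last by rewrite lee_fin load_ge0.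
by rewrite sumEFin EFinD ge0_muleDl ?lee_fin ?ltW // mul1e.
Qed.

Lemma prob_slice_empty v :
  P [set x | slice_total (cnt x) v == 0%N] = (expR (- oload M v))%:E.
Proof.
pose F (j : (B * V) + (B * V * nat)) : set (sspace M) :=
  if j is inl i then ncust_pair i @^-1` [set 0%N] else setT.
pose s : seq ((B * V) + (B * V * nat)) := [seq inl (b, v) | b <- enum B].
have := @mutually_independent_seq _ _ _ _ _ _ s F (@primitives_independent _ _ _ M).
rewrite big_map big_enum /= => indep.
transitivity (P (\bigcap_(i in [set` s]) F i)).
  congr (P _); apply/seteqP; split => x /=.
    rewrite sum_nat_eq0 => /forallP xn j /= /mapP[b _ ->] /=.
    by apply/eqP; have := xn b; rewrite ffunE.
  move=> xF; rewrite sum_nat_eq0; apply/forallP => b /=; rewrite ffunE /=.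
  apply/eqP; apply: (xF (inl (b, v))) => /=.
  by apply/mapP; exists b => //; rewrite mem_enum.
rewrite indep.
- under eq_bigr do rewrite ncust_pmf pois0 ?load_ge0 //.
  by rewrite prodEFin -expR_sum /oload sumrN.
- by rewrite map_inj_uniq ?enum_uniq // => b b' [].
- by move=> j /mapP[b _ ->]; exists [set 0%N] => //; rewrite setTI.
Qed.

Lemma Ecounts_slice_inv v :
  E (fun n => (slice_total n v).+1%:R^-1) =
  ((1 - expR (- oload M v)) / oload M v)%:E.
Proof.
have /lt0r_neq0 l0 := oload_pos v.
have inv0 k : 0 <= (k%:R : R)^-1 by rewrite invr_ge0.
have : ((oload M v)%:E * E (fun n => ((slice_total n v).+1%:R^-1)%R) =
        (1 - expR (- oload M v))%R%:E)%E.
  transitivity (E (fun n => (slice_total n v != 0%N)%:R)).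
    rewrite /oload -sumEFin ge0_sume_distrl; last first.
      by move=> b _; rewrite lee_fin load_ge0.
    (* The Mecke formula read from right to left: the increment turns [N^v] into [N^v + 1]. *)
    have shift b : ((load M b v)%:E * E (fun n => ((slice_total n v).+1%:R^-1)%R) =
        E (fun n => (n (b, v))%:R * (slice_total n v)%:R^-1)%R)%E.
      rewrite mecke_ncust //; congr (_ * _)%E; apply: eq_Ecounts => n.
      by rewrite slice_total_incr eqxx addn1.
    under eq_bigr do rewrite shift.
    rewrite -Ecounts_sum => [|b n]; last by rewrite mulr_ge0.
    apply: eq_Ecounts => n; rewrite -mulr_suml -natr_sum -/(slice_total n v).
    (* For an empty slice the quotient is 0, like the indicator. *)
    have [->|n0] := eqVneq (slice_total n v) 0%N; first by rewrite mul0r.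
    by rewrite mulfV // pnatr_eq0.
  rewrite Ecounts_indic (_ : [set x | _] = ~` [set x | slice_total (cnt x) v == 0%N]).
    rewrite probability_setC; first by rewrite prob_slice_empty EFinB.
    rewrite -[X in measurable X]setTI.
    exact: (@measurable_fun_counts _ _ _ P _ ncust_pair _ bool
      (fun n => slice_total n v == 0%N) measurableT [set true]).
  by apply/seteqP; split => x /= /negP.
by move=> h; rewrite mulrC EFinM -h muleA -EFinM mulVf // mul1e.
Qed.

Lemma Ecounts_relative_count b v :
  E (fun n => (n (b, v))%:R / (slice_total n v)%:R) =
  (rload M b v * (1 - expR (- oload M v)))%:E.
Proof.
rewrite mecke_ncust => [|n]; last by rewrite invr_ge0.
under eq_Ecounts do rewrite slice_total_incr eqxx addn1.
by rewrite Ecounts_slice_inv -EFinM /rload; congr EFin; ring.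
Qed.

(** * Exact mean BTD under SS, GPS and SCPF *)

Lemma mean_btd_SS v :
  mean_btd M rate_SS v =
  (\sum_b rload M b v * delta M b v * ((load M b v + 1) / share M v))%:E.
Proof.
have /ltW s0 := share_gt0 M v.
rewrite (mean_btd_mecke (h := fun b n => (n (b, v))%:R / share M v)).
- rewrite -sumEFin; apply: eq_bigr => b _.
  under eq_Ecounts do rewrite ffunE eqxx addn1.
  by rewrite Ecounts_succ_ncust ?Ecounts_cst -?EFinM // => n; rewrite invr_ge0.
- by move=> b n; rewrite divr_ge0.
- by move=> b n c; rewrite /rate_SS invfM invf_div.
Qed.

(** In the shifted counts, slice [v] is certainly present at [b] and contributes its full share,
    while another slice [w] contributes its share times [1 - expR (- load M b w)]. Since the shares
    sum to 1, the total is [1 - sbar M b v]. *)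
Lemma mean_btd_GPS v :
  mean_btd M rate_GPS v =
  (\sum_b rload M b v * delta M b v *
     ((load M b v + 1) / share M v) * (1 - sbar M b v))%:E.
Proof.
have s0 w : 0 <= share M w by rewrite ltW // share_gt0.
rewrite (mean_btd_mecke (h := fun b n =>
  (n (b, v))%:R * (\sum_(w | (0 < n (b, w))%N) share M w) / share M v)).
- rewrite -sumEFin; apply: eq_bigr => b _.
  (* After the shift, [h] is [n (b, v) + 1] times this factor, which does not depend on
     [n (b, v)]. *)
  pose g n := (share M v)^-1 *
    (share M v + \sum_(w | w != v) share M w * (0 < n (b, w))%:R).
  have g0 n : 0 <= g n.
    rewrite mulr_ge0 ?invr_ge0 // addr_ge0 // sumr_ge0 // => w _.
    by rewrite mulr_ge0.
  rewrite (_ : E _ = E (fun n => (n (b, v)).+1%:R * g n)%R); last first.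
    apply: eq_Ecounts => n; rewrite ffunE eqxx addn1 /g -mulrA.
    congr (_ * _); rewrite mulrC; congr (_ * _).
    rewrite big_mkcond (bigD1 v) //= ffunE eqxx addn1 /=; congr (_ + _).
    apply: eq_bigr => w wv; rewrite ffunE xpair_eqE (negPf wv) andbF addn0.
    by case: ifP => _; rewrite ?mulr1 ?mulr0.
  rewrite Ecounts_succ_ncust // => [|n]; last first.
    rewrite /g; congr (_ * (_ + _)); apply: eq_bigr => w wv.
    by rewrite ffunE xpair_eqE (negPf wv) andbF addn0.
  rewrite EcountsZ ?invr_ge0 // => [|n]; last first.
    by rewrite addr_ge0 // sumr_ge0 // => w _; rewrite mulr_ge0.
  rewrite EcountsD // => [|n]; last first.
    by rewrite sumr_ge0 // => w _; rewrite mulr_ge0.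
  rewrite Ecounts_cst Ecounts_sum => [|w n]; last by rewrite mulr_ge0.
  under eq_bigr => w _.
    rewrite EcountsZ // Ecounts_indic.
    have -> : P [set x | (0 < cnt x (b, w))%N] = (1 - expR (- load M b w))%:E.
      rewrite -pois0 ?load_ge0 // EFinB -ncust_pmf -probability_setC; last first.
        by rewrite -[X in measurable X]setTI; exact: measurable_funPT.
      congr (P _); apply/seteqP; split => x /=; rewrite ffunE /= lt0n.
        by move=> /eqP.
      by move=> ?; apply/eqP.
    rewrite -EFinM.
    over.
  rewrite sumEFin -EFinD -!EFinM; congr EFin.
  rewrite -!mulrA; congr (_ * (_ * (_ * (_ * _)))).
  under eq_bigr do rewrite mulrBr mulr1.
  rewrite sumrB addrA -(bigD1 v (F := share M) (P := xpredT)) //=.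
  by rewrite share_sum1.
- by move=> b n; rewrite divr_ge0 // mulr_ge0 // sumr_ge0.
- by move=> b n c; rewrite /rate_GPS invfM invf_div.
Qed.

(** The term [w = v] of the denominator is split off. There the shifted total [N^v + 1] cancels,
    leaving [N_b^v + 1]. In the other terms [N^v + 1] multiplies [N_b^w / N^w], which involves slice
    [w] only, so the expectations multiply. *)
Lemma mean_btd_SCPF v :
  mean_btd M rate_SCPF v =
  (\sum_b rload M b v * delta M b v *
     (1 - rload M b v + (oload M v + 1) *
        (gtilde' M b / share M v + expR (- oload M v) * rload M b v)))%:E.
Proof.
have s0 w : 0 <= share M w by rewrite ltW // share_gt0.
have sv0 : share M v != 0 by rewrite gt_eqF // share_gt0.
rewrite (mean_btd_mecke (h := fun b n =>
  (\sum_(w | (0 < slice_total n w)%N)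
     (n (b, w))%:R * share M w / (slice_total n w)%:R) *
  ((slice_total n v)%:R / share M v))).
- rewrite -sumEFin; apply: eq_bigr => b _.
  pose g w n := (n (b, w))%:R / (slice_total n w)%:R : R.
  have g0 w n : 0 <= g w n by rewrite divr_ge0.
  have gi w b' n : w != v -> g w (incr (b', v) n) = g w n.
    move=> wv; rewrite /g slice_total_incr ffunE xpair_eqE (negPf wv) andbF.
    by rewrite !addn0.
  rewrite (_ : E _ = E (fun n => (n (b, v)).+1%:R * 1 +
    \sum_(w | w != v) share M w / share M v *
       ((slice_total n v).+1%:R * g w n))%R); last first.
    apply: eq_Ecounts => n.
    rewrite big_mkcond (bigD1 v) //= slice_total_incr eqxx addn1 /= mulrDl.
    congr (_ + _).
      rewrite ffunE eqxx addn1 mulr1.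
      have : (slice_total n v).+1%:R != 0 :> R by rewrite pnatr_eq0.
      by move: (slice_total n v).+1%:R => a a0; field; rewrite a0 sv0.
    rewrite mulr_suml; apply: eq_bigr => w wv.
    rewrite -(gi w b n wv) /g.
    (* An empty slice, excluded from the sum, would contribute 0 anyway because [0^-1 = 0]. *)
    have [->|_] := posnP (slice_total (incr (b, v) n) w).
      by rewrite invr0 !mulr0 mul0r.
    by move: (slice_total _ _)%:R^-1 => i; ring.
  rewrite EcountsD => [|n|n]; first last.
  - by rewrite sumr_ge0 // => w _; rewrite mulr_ge0 ?divr_ge0 // mulr_ge0.
  - by rewrite mulr1.
  rewrite Ecounts_succ_ncust // Ecounts_cst mule1.
  rewrite Ecounts_sum => [|w n]; last by rewrite mulr_ge0 ?divr_ge0 // mulr_ge0.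
  under eq_bigr => w wv.
    rewrite EcountsZ ?divr_ge0 // => [|n]; last by rewrite mulr_ge0.
    rewrite Ecounts_succ_slice // => [|b' n]; last exact: gi.
    rewrite Ecounts_relative_count -!EFinM.
    over.
  rewrite sumEFin -EFinD -EFinM; congr EFin; congr (_ * _).
  have /lt0r_neq0 l0 := oload_pos v.
  (* In the closed form, the own term of [gtilde'] and the term in [expR (- oload M v)] add up to
     [rload M b v]; then [1 - rload + (oload + 1) * rload] is [load + 1]. *)
  have loadE : load M b v = rload M b v * oload M v by rewrite /rload divfK.
  rewrite loadE /gtilde' [in RHS](bigD1 v) //=.
  rewrite (eq_bigr (fun w => (oload M v + 1) / share M v * (share M w *
    (1 - expR (- oload M w)) * rload M b w))); last by move=> w _; ring.
  by rewrite -mulr_sumr; move: (\sum_(_ | _) _) => S; field.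
- move=> b n; rewrite mulr_ge0 ?divr_ge0 // sumr_ge0 // => w _.
  by rewrite divr_ge0 // mulr_ge0.
- by move=> b n c; rewrite /rate_SCPF invfM !invf_div.
Qed.

End model.

(** * Large loads with fixed relative loads *)

Section asymptotics.
Context {R : realType} {B V : finType}.
Implicit Types (M : slicing_model R B V) (b : B) (v w : V).

Definition scpf_main M v : R := oload M v / share M v *
  delta_dot M v (fun b => rload M b v) (gtilde M).

(** Built from shares, relative loads and mean reciprocal capacities only, hence constant along the
    families considered. The factor [1 + 1 / s^v] bounds both the load-free part of the error and
    the coefficient of the exponentials. *)
Definition scpf_gap_cst M v : R :=
  (\sum_b rload M b v * delta M b v) * (1 + (share M v)^-1).

Lemma rload_ge0 M b v : 0 <= rload M b v.
Proof. by rewrite divr_ge0 ?load_ge0 // ltW // oload_pos. Qed.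

Lemma rload_sum1 M v : \sum_b rload M b v = 1.
Proof. by rewrite -mulr_suml mulfV // gt_eqF // oload_pos. Qed.

Lemma rload_le1 M b v : rload M b v <= 1.
Proof.
rewrite -(rload_sum1 M v) (bigD1 b) //= lerDl sumr_ge0 // => b' _.
exact: rload_ge0.
Qed.

Lemma share_le1 M v : share M v <= 1.
Proof.
rewrite -(share_sum1 M) (bigD1 v) //= lerDl sumr_ge0 // => w _.
by rewrite ltW // share_gt0.
Qed.

Lemma gtilde_ge0 M b : 0 <= gtilde M b.
Proof.
rewrite sumr_ge0 // => w _.
by rewrite mulr_ge0 ?rload_ge0 // ltW // share_gt0.
Qed.

Lemma gtilde_le1 M b : gtilde M b <= 1.
Proof.
rewrite -(share_sum1 M) ler_sum // => w _.
by rewrite ler_piMr ?rload_le1 // ltW // share_gt0.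
Qed.

(** If the sum vanished, so would each term; as [gtilde M b] contains [share M v * rload M b v], all
    relative loads of [v] would be 0, though they sum to 1. Positivity lets the main term absorb
    bounded errors. *)
Lemma delta_dot_gt0 M v : 0 < delta_dot M v (fun b => rload M b v) (gtilde M).
Proof.
have t0 b : 0 <= rload M b v * delta M b v * gtilde M b.
  rewrite mulr_ge0 ?gtilde_ge0 // mulr_ge0 ?rload_ge0 //.
  by rewrite ltW // delta_gt0.
rewrite lt_neqAle sumr_ge0 // andbT eq_sym; apply/negP => /eqP D0.
have r0 b : rload M b v = 0.
  have /eqP : rload M b v * delta M b v * gtilde M b = 0.
    by apply: (psumr_eq0P _ D0) => [b' _|]; [exact: t0|].
  rewrite mulf_eq0 => /orP[|].
    by rewrite mulf_eq0 (gt_eqF (delta_gt0 _ _ _)) orbF => /eqP.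
  rewrite /gtilde psumr_eq0 => [|w _]; last first.
    by rewrite mulr_ge0 ?rload_ge0 // ltW // share_gt0.
  move=> /allP /(_ v); rewrite mem_index_enum => /(_ isT) /=.
  by rewrite mulf_eq0 gt_eqF ?share_gt0 // => /eqP.
have := rload_sum1 M v; rewrite big1 // => /esym/eqP.
by rewrite oner_eq0.
Qed.

Lemma scpf_gap_cst_ge0 M v : 0 <= scpf_gap_cst M v.
Proof.
rewrite mulr_ge0 //; last by rewrite addr_ge0 // invr_ge0 ltW // share_gt0.
by rewrite sumr_ge0 // => b _; rewrite mulr_ge0 ?rload_ge0 // ltW // delta_gt0.
Qed.

Lemma scpf_gap_bound M v :
  `|fine (mean_btd M rate_SCPF v) - scpf_main M v| <=
  scpf_gap_cst M v * (1 + (oload M v + 1) * \sum_w expR (- oload M w)).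
Proof.
have sv0 := share_gt0 M v.
have si0 : 0 <= (share M v)^-1 by rewrite invr_ge0 ltW.
have l0 := oload_pos M v.
have e0 w : 0 <= expR (- oload M w) by rewrite expR_ge0.
pose S := \sum_w expR (- oload M w).
have eS : expR (- oload M v) <= S.
  by rewrite /S (bigD1 v) //= lerDl sumr_ge0.
(* Writing [gtilde'] as [gtilde] minus an exponentially weighted sum, the part
   [oload * gtilde / share] cancels against the main term, and the [+ 1] of [oload + 1] leaves
   [gtilde / share]. *)
have -> : fine (mean_btd M rate_SCPF v) - scpf_main M v =
    \sum_b rload M b v * delta M b v *
      (1 - rload M b v + gtilde M b / share M v +
       (oload M v + 1) * (expR (- oload M v) * rload M b v -
         (\sum_w share M w * expR (- oload M w) * rload M b w) / share M v)).
  rewrite mean_btd_SCPF /= /scpf_main /delta_dot mulr_sumr -sumrB.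
  apply: eq_bigr => b _.
  have -> : gtilde' M b = gtilde M b -
      \sum_w share M w * expR (- oload M w) * rload M b w.
    by rewrite -sumrB; apply: eq_bigr => w _; ring.
  by move: (\sum_w _) => X; field; rewrite gt_eqF.
rewrite (le_trans (ler_norm_sum _ _ _)) // /scpf_gap_cst -mulrA mulr_suml.
apply: ler_sum => b _; have d0 := ltW (delta_gt0 M b v).
have r0 := rload_ge0 M b v; have r1 := rload_le1 M b v.
have rd0 : 0 <= rload M b v * delta M b v by exact: mulr_ge0.
rewrite normrM (ger0_norm rd0) ler_wpM2l //.
have g0 := gtilde_ge0 M b; have g1 := gtilde_le1 M b.
set X := \sum_w share M w * _ * _.
have X0 : 0 <= X.
  rewrite sumr_ge0 // => w _; rewrite mulr_ge0 ?rload_ge0 // mulr_ge0 //.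
  by rewrite ltW // share_gt0.
have XS : X <= S.
  apply: ler_sum => w _; rewrite -[leRHS]mulr1 ler_pM ?rload_ge0 ?rload_le1 //.
    by rewrite mulr_ge0 // ltW // share_gt0.
  by rewrite ler_piMl // share_le1.
rewrite -/S; set i := (share M v)^-1; set e := expR _.
have h1 : `|1 - rload M b v + gtilde M b * i| <= 1 + i.
  have gi0 : 0 <= gtilde M b * i by exact: mulr_ge0.
  have gi1 : gtilde M b * i <= i by rewrite ler_piMl.
  by rewrite ger0_norm; lra.
have h2 : `|e * rload M b v - X * i| <= (1 + i) * S.
  have er0 : 0 <= e * rload M b v by rewrite mulr_ge0 ?expR_ge0.
  have Xi0 : 0 <= X * i by exact: mulr_ge0.
  rewrite (le_trans (ler_normB _ _)) // (ger0_norm er0) (ger0_norm Xi0) mulrDl mul1r.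
  rewrite lerD //; first by rewrite (le_trans _ eS) // ler_piMr ?expR_ge0.
  by rewrite mulrC ler_wpM2l.
have l1 : 0 <= oload M v + 1 by rewrite addr_ge0 // ltW.
rewrite (le_trans (ler_normD _ _)) // normrM (ger0_norm l1).
rewrite (_ : (1 + i) * _ = 1 + i + (oload M v + 1) * ((1 + i) * S)); last by ring.
by rewrite lerD // ler_wpM2l.
Qed.

Variables (I : Type) (F : filter_on I) (M : I -> slicing_model R B V) (v : V).
Variables (K kappa : R).
Hypothesis KE : forall t, scpf_gap_cst (M t) v = K.
Hypothesis kappaE : forall t, scpf_main (M t) v = kappa * oload (M t) v.
Hypothesis oload_cvg : forall w, oload (M t) w @[t --> F] --> +oo.

(** Once every overall load exceeds [A], each exponential is at most [1 / A]. The error is then at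
    most a constant plus a small multiple of [oload (M t) v], whereas the main term is [kappa] times
    that load. *)
Lemma scpf_littleo :
  (fun t => fine (mean_btd (M t) rate_SCPF v) : R^o) =
  (fun t => scpf_main (M t) v : R^o) +o_F (fun t => scpf_main (M t) v : R^o).
Proof.
apply/eqaddoP => eps eps0.
(* The signs of [K] and [kappa] are read off at some index [t0]; over an empty index type the claim
   is trivial. *)
have [[t0]|noI] := pselect (inhabited I); last first.
  by apply: filterE => t; case: noI.
have K_ge0 : 0 <= K by rewrite -(KE t0) scpf_gap_cst_ge0.
have kappa_gt0 : 0 < kappa.
  rewrite -(pmulr_lgt0 _ (oload_pos (M t0) v)) -kappaE mulr_gt0 //.
    by rewrite divr_gt0 ?oload_pos ?share_gt0.
  exact: delta_dot_gt0.
pose m : R := #|V|%:R.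
(* With [S <= m / A], [l + 1 <= 2 * l] and [A <= l], the error times [A] is at most
   [l * (K + 2 * K * m)]; this [A] makes twice that bound at most [l * A * eps * kappa]. *)
pose A := 1 + (2 * K + 4 * K * m) / (eps * kappa).
have m0 : 0 <= m by [].
have ek0 : 0 < eps * kappa by rewrite mulr_gt0.
have A1 : 1 <= A by rewrite lerDl divr_ge0 ?addr_ge0 ?mulr_ge0 // ltW.
have A0 : 0 < A by rewrite (lt_le_trans _ A1).
have Aek : 2 * K + 4 * K * m <= A * (eps * kappa).
  by rewrite /A [leRHS]mulrDl divfK ?gt_eqF // mul1r lerDr ltW.
have : \forall t \near F, forall w, A <= oload (M t) w.
  by apply: filter_forall => w; have /cvgryPge := oload_cvg w; exact.
apply: filterS => t At; rewrite !fctE.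
rewrite (le_trans (scpf_gap_bound _ _)) // KE kappaE.
have lA := At v; set l := oload (M t) v in lA *.
have l0 : 0 < l by rewrite (lt_le_trans A0).
rewrite ger0_norm ?mulr_ge0 ?(ltW l0) ?(ltW kappa_gt0) //.
have SA : A * (\sum_w expR (- oload (M t) w)) <= m.
  rewrite mulr_sumr /m -sum1_card natr_sum ler_sum // => w _.
  rewrite expRN -ler_pdivlMr ?invr_gt0 ?expR_gt0 // invrK mul1r.
  rewrite (le_trans (At w)) // (le_trans _ (expR_ge1Dx _)) //.
  by rewrite lerDr.
have S0 : 0 <= \sum_w expR (- oload (M t) w).
  by rewrite sumr_ge0 // => w _; rewrite expR_ge0.
move: (\sum_w _) SA S0 => S SA S0.
rewrite -(ler_pM2l A0).
have KS : K * (A * S) <= K * m by rewrite ler_wpM2l.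
have KSl : (l + 1) * (K * (A * S)) <= (2 * l) * (K * m).
  apply: ler_pM => //; try lra.
  by rewrite mulr_ge0 // mulr_ge0 // ltW.
have KA : 2 * K * A <= 2 * K * l by rewrite ler_wpM2l // mulr_ge0.
have lAek : l * (2 * K + 4 * K * m) <= l * (A * (eps * kappa)).
  by rewrite ler_wpM2l // ltW.
have Km : 0 <= K * m by rewrite mulr_ge0.
have lKm : 0 <= l * (K * m) by rewrite mulr_ge0 // ltW.
nra.
Qed.

(** The error contains [oload v * expR (- oload w)], which may be unbounded if the slices grow at
    very different speeds; the growth hypothesis bounds it by a constant [k w]. *)
Lemma scpf_bigO :
  (forall w, (fun t => oload (M t) v : R^o)
             =O_F (fun t => expR (oload (M t) w) : R^o)) ->
  (fun t => fine (mean_btd (M t) rate_SCPF v) : R^o) =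
  (fun t => scpf_main (M t) v : R^o) +O_F (fun=> 1 : R^o).
Proof.
move=> growth.
have /choice[k kP] : forall w, exists k : R, \forall t \near F,
    oload (M t) v <= k * expR (oload (M t) w).
  move=> w; have /eqOP [k0 [_ /(_ (k0 + 1))]] := growth w.
  rewrite ltrDl ltr01 => /(_ isT) H; exists (k0 + 1).
  apply: filterS H => t; rewrite !ger0_norm ?expR_ge0 // ltW //.
  exact: oload_pos.
apply/eqaddOP.
(* In [k w + 1], the 1 bounds the lone [expR (- oload w)] coming from the factor [oload v + 1]. *)
exists (K * (1 + \sum_w (k w + 1))); split; first exact: num_real.
move=> C KC.
have : \forall t \near F, forall w, oload (M t) v <= k w * expR (oload (M t) w).
  by apply: filter_forall.
apply: filterS => t kt; rewrite !fctE.
rewrite normr1 mulr1 (le_trans _ (ltW KC)) //.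
rewrite (le_trans (scpf_gap_bound _ _)) // -(KE t) ler_wpM2l ?scpf_gap_cst_ge0 //.
rewrite lerD2l mulr_sumr.
apply: ler_sum => w _; rewrite mulrDl mul1r lerD //.
  by rewrite expRN ler_pdivrMr ?expR_gt0.
by rewrite -expR0 ler_expR oppr_le0 ltW // oload_pos.
Qed.

End asymptotics.

Theorem theorem1 (R : realType) (B V : finType) (v : V) :
  (* (i) *)
  (forall M : slicing_model R B V,
    mean_btd M rate_SCPF v =
    (\sum_b rload M b v * delta M b v *
       (1 - rload M b v + (oload M v + 1) *
          (gtilde' M b / share M v + expR (- oload M v) * rload M b v)))%:E) /\
  (* (ii) *)
  (forall (I : Type) (F : filter_on I)
      (M : I -> slicing_model R B V)
      (s : V -> R) (r d : B -> V -> R),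
    (forall t w, share (M t) w = s w) ->
    (forall t b w, rload (M t) b w = r b w) ->
    (forall t b w, delta (M t) b w = d b w) ->
    (forall w, oload (M t) w @[t --> F] --> +oo) ->
    let btd : I -> R^o := fun t => fine (mean_btd (M t) rate_SCPF v) in
    let main_term : I -> R^o := fun t =>
      oload (M t) v / share (M t) v *
      delta_dot (M t) v (fun b => rload (M t) b v) (gtilde (M t)) in
    btd = main_term +o_F main_term /\
    ((forall w, (fun t => oload (M t) v : R^o)
                =O_F (fun t => expR (oload (M t) w) : R^o)) ->
     btd = main_term +O_F (fun=> 1 : R^o))) /\
  (* (iii) *)
  (forall M : slicing_model R B V,
    mean_btd M rate_SS v =
    (\sum_b rload M b v * delta M b v *
       ((load M b v + 1) / share M v))%:E) /\
  (* (iv) *)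
  (forall M : slicing_model R B V,
    mean_btd M rate_GPS v =
    (\sum_b rload M b v * delta M b v *
       ((load M b v + 1) / share M v) * (1 - sbar M b v))%:E).

Proof.
split; first by move=> M; exact: mean_btd_SCPF.
split; last by split=> M; [exact: mean_btd_SS|exact: mean_btd_GPS].
move=> I F M s r d sE rE dE oload_cvg btd main_term.
(* The gap constant and the slope of the main term, expressed in the data shared by all the models
   [M t]. *)
pose K := (\sum_b r b v * d b v) * (1 + (s v)^-1).
pose kappa := (\sum_b r b v * d b v * \sum_w s w * r b w) / s v.
have KE t : scpf_gap_cst (M t) v = K.
  rewrite /scpf_gap_cst /K sE; congr (_ * _).
  by apply: eq_bigr => b _; rewrite rE dE.
have kappaE t : scpf_main (M t) v = kappa * oload (M t) v.
  rewrite /scpf_main /kappa sE mulrC mulrCA mulrC; congr (_ / _ * _).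
  apply: eq_bigr => b _; rewrite rE dE; congr (_ * _).
  by apply: eq_bigr => w _; rewrite sE rE.
split; first exact: (scpf_littleo KE kappaE oload_cvg).
exact: (scpf_bigO KE).
Qed.
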